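(* Let $\mathcal{A}$ be a nonempty upward closed collection of Turing degrees that has a countable (finite or countably infinite) basis. Then there exist equivalence relations $R$ and $S$ on $\omega$, each with infinitely many equivalence classes, such that $\mathrm{DgSp}_{\Rightarrow}(R,S)=\mathcal{A}$.
   Context: For equivalence relations $R,S$ on $\omega$ and a Turing degree $\mathbf{d}$, write $R\leq_{\mathbf{d}} S$ if there is a $\mathbf{d}$-computable function $f:\omega\to\omega$ such that for all $x,y\in\omega$, $x R y \Leftrightarrow f(x) S f(y)$. The reducibility spectrum of $(R,S)$ is $\mathrm{DgSp}_{\Rightarrow}(R,S)=\{\mathbf{d} : R\leq_{\mathbf{d}} S\}$. A collection $\mathcal{A}$ of Turing degrees is upward closed if $\mathbf{a}\in\mathcal{A}$ and $\mathbf{a}\leq\mathbf{d}$ imply $\mathbf{d}\in\mathcal{A}$. A set $\mathcal{B}$ of Turing degrees is a basis of $\mathcal{A}$ if (1) the elements of $\mathcal{B}$ are pairwise Turing-incomparable, and (2) $\mathcal{A}=\{\mathbf{d} : (\exists \mathbf{b}\in\mathcal{B})(\mathbf{b}\leq\mathbf{d})\}$. *)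

(* Defs.v *)
From Stdlib Require Export Relation_Definitions RelationClasses.
From mathcomp Require Export all_boot all_classical.

Set Implicit Arguments.
Unset Strict Implicit.
Unset Printing Implicit Defensive.

Local Open Scope classical_set_scope.
Local Open Scope quotient_scope.

(* Descriptions of the partial functions nat^n -> nat that are mu-recursive
   relative to an oracle function. *)
Inductive code : nat -> Type :=
  | Zero : code 0
  | Succ : code 1
  | Proj n : 'I_n -> code n
  | Oracle : code 1
  | Comp m n : code m -> ('I_m -> code n) -> code n
  | PrimRec n : code n -> code n.+2 -> code n.+1
  | Mu n : code n.+1 -> code n.

(* [eval o c v y]: the partial function described by [c], with oracle [o], is
   defined at [v] and takes the value [y] there. The recursion variable of
   [PrimRec] and the search variable of [Mu] are the first argument. *)
Fixpoint eval (o : nat -> nat) n (c : code n) : n.-tuple nat -> nat -> Prop :=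
  match c in code n return n.-tuple nat -> nat -> Prop with
  | Zero => fun _ y => y = 0
  | Succ => fun v y => y = (thead v).+1
  | Proj _ i => fun v y => y = tnth v i
  | Oracle => fun v y => y = o (thead v)
  | Comp m _ f g => fun v y =>
      exists2 w : m.-tuple nat,
        forall i, eval o (g i) v (tnth w i) & eval o f w y
  | PrimRec _ f g => fun v =>
      let fix rec k y := match k with
        | 0 => eval o f (behead_tuple v) y
        | k'.+1 => exists2 z, rec k' z
            & eval o g (cons_tuple k' (cons_tuple z (behead_tuple v))) y
        end in
      rec (thead v)
  | Mu _ f => fun v y =>
      eval o f (cons_tuple y v) 0
      /\ forall k, k < y -> exists z, eval o f (cons_tuple k v) z.+1
  end.

Lemma eval_inj o n (c : code n) v y y' : eval o c v y -> eval o c v y' -> y = y'.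
Proof.
elim: c v y y' => [||n' i||m n' f IHf g IHg|n' f IHf g IHg|n' f IHf] v y y' /=.
- by move=> -> ->.
- by move=> -> ->.
- by move=> -> ->.
- by move=> -> ->.
- move=> [w gw fw] [w' gw' fw'].
  have ww' : w = w' by apply: eq_from_tnth => i; exact: IHg (gw i) (gw' i).
  by rewrite -ww' in fw'; exact: IHf fw fw'.
- elim: (thead v) y y' => [|k IHk] y y'; first exact: IHf.
  by move=> [z rz gz] [z' rz' gz']; rewrite -(IHk _ _ rz rz') in gz';
    exact: IHg gz gz'.
- move=> [f0 lt0] [f0' lt0']; case: (ltngtP y y') => // [/lt0'|/lt0] [z fz].
    by have := IHf _ _ _ f0 fz.
  by have := IHf _ _ _ f0' fz.
Qed.

Definition oracle (X : set nat) (n : nat) : nat := n \in X.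

Definition computable_from (X : set nat) (f : nat -> nat) : Prop :=
  exists c : code 1, forall x, eval (oracle X) c [tuple x] (f x).

Definition turing_le (X Y : set nat) : Prop := computable_from Y (oracle X).

Lemma turing_le_refl X : turing_le X X.
Proof. by exists Oracle. Qed.

(* [c] with the oracle queries answered by the program [q]. *)
Fixpoint subst_oracle (q : code 1) n (c : code n) : code n :=
  match c with
  | Zero => Zero
  | Succ => Succ
  | Proj _ i => Proj i
  | Oracle => q
  | Comp _ _ f g => Comp (subst_oracle q f) (fun i => subst_oracle q (g i))
  | PrimRec _ f g => PrimRec (subst_oracle q f) (subst_oracle q g)
  | Mu _ f => Mu (subst_oracle q f)
  end.

Lemma eval_subst_oracle o o' q n (c : code n) v y :
  (forall x, eval o' q [tuple x] (o x)) ->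
  eval o c v y -> eval o' (subst_oracle q c) v y.
Proof.
move=> qo; elim: c v y => [||n' i||m n' f IHf g IHg|n' f IHf g IHg|n' f IHf] v y //=.
- move=> ->; have -> : v = [tuple thead v]; last exact: qo.
  by apply: eq_from_tnth => i; rewrite !ord1.
- by move=> [w gw fw]; exists w => [i|]; [exact: IHg|exact: IHf].
- elim: (thead v) y => [|k IHk] y; first exact: IHf.
  by move=> [z rz gz]; exists z; [exact: IHk|exact: IHg].
- move=> [f0 lt0]; split=> [|k /lt0[z fz]]; first exact: IHf.
  by exists z; exact: IHf.
Qed.

Lemma computable_from_le X Y f :
  turing_le X Y -> computable_from X f -> computable_from Y f.
Proof.
move=> [q qX] [c cf]; exists (subst_oracle q c) => x.
exact: eval_subst_oracle (cf x).
Qed.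

Definition turing_equiv (X Y : set nat) : bool :=
  `[< turing_le X Y /\ turing_le Y X >].

Lemma turing_equiv_refl : reflexive turing_equiv.
Proof. by move=> X; apply/asboolP; split; exact: turing_le_refl. Qed.

Lemma turing_equiv_sym : symmetric turing_equiv.
Proof. by move=> X Y; apply/asboolP/asboolP => -[]. Qed.

Lemma turing_equiv_trans : transitive turing_equiv.
Proof.
move=> Y X Z /asboolP[XY YX] /asboolP[YZ ZY]; apply/asboolP.
by split; [exact: computable_from_le YZ XY|exact: computable_from_le YX ZY].
Qed.

Canonical turing_equiv_rel :=
  EquivRel turing_equiv turing_equiv_refl turing_equiv_sym turing_equiv_trans.

Definition turing_degree := {eq_quot turing_equiv}.

Definition degree_of (X : set nat) : turing_degree := \pi X.

Definition degree_le (a b : turing_degree) : Prop :=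
  turing_le (repr a) (repr b).

Definition degree_computable (d : turing_degree) (f : nat -> nat) : Prop :=
  computable_from (repr d) f.

Lemma degree_computableE X f :
  degree_computable (degree_of X) f <-> computable_from X f.
Proof.
have /eqmodP/asboolP[le1 le2] : repr (degree_of X) = X %[mod turing_degree].
  by rewrite reprK.
by split; exact: computable_from_le.
Qed.

Lemma degree_leE X Y : degree_le (degree_of X) (degree_of Y) <-> turing_le X Y.
Proof.
have /eqmodP/asboolP[le1 le2] : repr (degree_of X) = X %[mod turing_degree].
  by rewrite reprK.
split=> [/degree_computableE rXY|XY]; first exact: computable_from_le rXY le2.
by apply/degree_computableE; exact: computable_from_le XY le1.
Qed.

Definition reducible (d : turing_degree) (R S : relation nat) : Prop :=
  exists2 f : nat -> nat,
    degree_computable d f & forall x y, R x y <-> S (f x) (f y).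

Definition reducibility_spectrum (R S : relation nat) : set turing_degree :=
  [set d | reducible d R S].

Definition upward_closed (A : set turing_degree) : Prop :=
  forall a d, A a -> degree_le a d -> A d.

Definition is_basis (B A : set turing_degree) : Prop :=
  (forall b c, B b -> B c -> b <> c -> ~ degree_le b c /\ ~ degree_le c b)
  /\ A = [set d | exists2 b, B b & degree_le b d].

Definition equivalence_classes (R : relation nat) : set (set nat) :=
  [set [set y | R x y] | x in [set: nat]].

(* Main.v *)
(** Let [X 0], [X 1], ... represent the degrees of the basis. Take equality for
    [R], so that a reduction to [S] is an infinite sequence of pairwise
    [S]-inequivalent numbers. Let [S] collapse all numbers to one class, except
    that each code of a triple (i, initial segment of [X i] of length > i,
    initial segment of [X 0] of length i + 1) is a class by itself. From [X i]
    one computes the codes of index [i]. Conversely, let [f] be a sequence of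
    codes. If infinitely many of them have the same index [i], search among
    these computes [X i] from [f]; otherwise the indices are unbounded and the
    last components compute [X 0]. *)

Require Import Defs.
From mathcomp Require Import all_boot all_classical.

Set Implicit Arguments.
Unset Strict Implicit.
Unset Printing Implicit Defensive.

Local Open Scope classical_set_scope.

(** * Closure properties of the functions recursive in an oracle *)

(** Functions on [seq nat] rather than on tuples, so that argument lists built
    by consing reduce by computation; only the values at length [n] matter. *)
Definition computes (o : nat -> nat) (n : nat) (F : seq nat -> nat) : Prop :=
  exists c : code n, forall v : n.-tuple nat, eval o c v (F v).

Lemma computes_ext o n F G :
  computes o n F -> (forall v, size v = n -> F v = G v) -> computes o n G.
Proof.
by move=> [c cF] FG; exists c => v; rewrite -FG; [exact: cF|exact: size_tuple].
Qed.

Lemma computable_fromE X f :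
  computable_from X f <-> computes (oracle X) 1 (fun v => f (nth 0 v 0)).
Proof.
split=> -[c cf]; exists c; last by move=> x; exact: (cf [tuple x]).
by move=> v; case/tupleP: v => x v; rewrite (tuple0 v); exact: cf.
Qed.

Lemma computes_proj o n i : i < n -> computes o n (fun v => nth 0 v i).
Proof.
by move=> lt_in; exists (Proj (Ordinal lt_in)) => v /=; rewrite (tnth_nth 0).
Qed.

Lemma computes_comp o m n F (G : nat -> seq nat -> nat) :
  computes o m F -> (forall i, i < m -> computes o n (G i)) ->
  computes o n (fun v => F (mkseq (G ^~ v) m)).
Proof.
move=> [c cF] cG.
have [g gG] := boolp.choice (fun i : 'I_m => cG i (ltn_ord i)).
exists (Comp c g) => v /=; exists [tuple of mkseq (G ^~ v) m] => [i|]; last exact: cF.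
by rewrite (tnth_nth 0) /= nth_mkseq //; exact: gG.
Qed.

Lemma computes_comp1 o n h F : computes o 1 (fun v => h (nth 0 v 0)) ->
  computes o n F -> computes o n (fun v => h (F v)).
Proof. by move=> ch cF; apply: (computes_comp (G := fun=> F) ch). Qed.

Lemma computes_comp2 o n h F G :
  computes o 2 (fun v => h (nth 0 v 0) (nth 0 v 1)) ->
  computes o n F -> computes o n G -> computes o n (fun v => h (F v) (G v)).
Proof.
move=> ch cF cG.
by apply: (computes_comp (G := fun i => if i is 0 then F else G) ch) => -[].
Qed.

Lemma computes_succ o n F : computes o n F -> computes o n (fun v => (F v).+1).
Proof.
by apply: computes_comp1; exists Succ => v /=; rewrite /thead (tnth_nth 0).
Qed.

Lemma computes_const o n a : computes o n (fun=> a).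
Proof.
elim: a => [|a IHa]; last exact: computes_succ IHa.
apply: (computes_comp (F := fun=> 0) (m := 0) (G := fun=> fun=> 0)) => //.
by exists Zero.
Qed.

Lemma computes_rec o n K B G :
  computes o n K -> computes o n B -> computes o n.+2 G ->
  computes o n (fun v => nat_rect (fun=> nat) (B v) (fun j z => G (j :: z :: v)) (K v)).
Proof.
move=> cK [b bB] [g gG].
have cR : computes o n.+1 (fun w => nat_rect (fun=> nat) (B (behead w))
    (fun j z => G (j :: z :: behead w)) (nth 0 w 0)).
  exists (PrimRec b g) => w /=; rewrite /thead (tnth_nth 0) /=.
  elim: (nth 0 w 0) => [|k IHk] /=; first exact: (bB (behead_tuple w)).
  by eexists; [exact: IHk|exact: (gG (cons_tuple _ (cons_tuple _ (behead_tuple w))))].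
(* [PrimRec] recurses on its first argument, so [K v] is put in front of the list [v]. *)
apply: computes_ext (computes_comp (G := fun i v => nth 0 (K v :: v) i) cR _) _.
  by case=> // i lt_in; exact: computes_proj.
by move=> v <-; rewrite -[X in mkseq _ X]/(size (K v :: v)) mkseq_nth.
Qed.

Lemma computes_mu o n F (exF : forall v, exists y, F (y :: v) == 0) :
  computes o n.+1 F -> computes o n (fun v => ex_minn (exF v)).
Proof.
move=> [c cF]; exists (Mu c) => v /=; case: ex_minnP => y /eqP Fy0 min_y.
split=> [|k lt_ky]; first by rewrite -Fy0; exact: (cF (cons_tuple y v)).
exists (F (k :: v)).-1; rewrite prednK; first exact: (cF (cons_tuple k v)).
by rewrite lt0n; apply: contraTN lt_ky => /min_y; rewrite -leqNgt.
Qed.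

Lemma computes_add o n F G :
  computes o n F -> computes o n G -> computes o n (fun v => F v + G v).
Proof.
move=> cF cG.
apply: computes_ext (computes_rec (G := fun w => (nth 0 w 1).+1) cG cF _) _.
  by apply: computes_succ; exact: computes_proj.
by move=> v _; elim: (G v) => [|k /= ->]; rewrite ?addn0 ?addnS.
Qed.

Lemma computes_mul o n F G :
  computes o n F -> computes o n G -> computes o n (fun v => F v * G v).
Proof.
apply: computes_comp2.
apply: computes_ext (computes_rec (G := fun w => nth 0 w 1 + nth 0 w 2)
  (computes_proj _ (isT : 1 < 2)) (computes_const _ _ 0) _) _.
  by apply: computes_add; exact: computes_proj.
by move=> v _ /=; elim: (nth 0 v 1) => [|k /= ->]; rewrite ?muln0 // mulnSr.
Qed.

Lemma computes_sub o n F G :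
  computes o n F -> computes o n G -> computes o n (fun v => F v - G v).
Proof.
have cpred m H : computes o m H -> computes o m (fun v => (H v).-1).
  move=> cH; apply: computes_ext (computes_rec (G := fun w => nth 0 w 0) cH
    (computes_const _ _ 0) _) _; first exact: computes_proj.
  by move=> v _; case: (H v).
move=> cF cG.
apply: computes_ext (computes_rec (G := fun w => (nth 0 w 1).-1) cG cF _) _.
  by apply: cpred; exact: computes_proj.
by move=> v _; elim: (G v) => [|k /= ->]; rewrite ?subn0 ?subnS.
Qed.

Lemma computes_leq o n F G :
  computes o n F -> computes o n G -> computes o n (fun v => F v <= G v : nat).
Proof.
move=> cF cG.
apply: computes_ext (computes_sub (computes_const _ _ 1) (computes_sub cF cG)) _.
by move=> v _; rewrite /leq; case: (F v - G v).
Qed.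

Lemma computes_odd o n F : computes o n F -> computes o n (fun v => odd (F v)).
Proof.
move=> cF; apply: computes_ext (computes_rec (G := fun w => 1 - nth 0 w 1) cF
  (computes_const _ _ 0) _) _.
  by apply: computes_sub; [exact: computes_const|exact: computes_proj].
by move=> v _; elim: (F v) => [|k /= ->]; rewrite //=; case: odd.
Qed.

Lemma computes_exp o n b F : computes o n F -> computes o n (fun v => b ^ F v).
Proof.
move=> cF; apply: computes_ext (computes_rec (G := fun w => nth 0 w 1 * b) cF
  (computes_const _ _ 1) _) _.
  by apply: computes_mul; [exact: computes_proj|exact: computes_const].
by move=> v _; elim: (F v) => [|k /= ->]; rewrite ?expn0 ?expnSr.
Qed.

Definition digit (e k : nat) : nat := e %/ 8 ^ k %% 8.

Lemma computes_digit o n F G :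
  computes o n F -> computes o n G -> computes o n (fun v => digit (F v) (G v)).
Proof.
have cdiv m H K : computes o m H -> computes o m K ->
    computes o m (fun v => H v %/ 8 ^ K v).
  apply: (computes_comp2 (h := fun e k => e %/ 8 ^ k)).
  (* With [w = [:: q; e; k]], [T w] vanishes iff [e < q.+1 * 8 ^ k]; the least such [q] is the
     quotient. *)
  pose T w := (nth 0 w 1).+1 - (nth 0 w 0).+1 * 8 ^ nth 0 w 2.
  have exT v : exists q, T (q :: v) == 0.
    exists (nth 0 v 0); rewrite /T /= subn_eq0 leq_pmulr //.
    by rewrite expn_gt0.
  apply: computes_ext (computes_mu exT _) _.
    apply: computes_sub; first by apply: computes_succ; exact: computes_proj.
    apply: computes_mul; first by apply: computes_succ; exact: computes_proj.
    by apply: computes_exp; exact: computes_proj.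
  move=> v _; case: ex_minnP => q; rewrite /T /= subn_eq0 => Tq min_q.
  have pos8 : 0 < 8 ^ nth 0 v 1 by rewrite expn_gt0.
  apply/eqP; rewrite eqn_leq min_q ?subn_eq0 /= ?ltn_ceil //.
  by rewrite -ltnS ltn_divLR.
move=> cF cG; have cD := cdiv _ _ _ cF cG.
apply: computes_ext (computes_sub cD (computes_mul
  (cdiv _ _ _ cD (computes_const _ _ 1)) (computes_const _ _ 8))) _.
by move=> v _; rewrite /digit expn1 {1}(divn_eq (F v %/ 8 ^ G v) 8) addKn.
Qed.

(** [P e k] recognises an [e] from which [h] reads off correctly whether [k] is in [X]. The first
    such value of [f] is found by unbounded search, which always ends. *)
Lemma turing_le_search (X D : set nat) (f : nat -> nat) (P h : nat -> nat -> bool) :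
  computable_from D f ->
  computes (oracle D) 2 (fun v => P (nth 0 v 0) (nth 0 v 1)) ->
  computes (oracle D) 2 (fun v => h (nth 0 v 0) (nth 0 v 1)) ->
  (forall k, exists m, P (f m) k) ->
  (forall m k, P (f m) k -> h (f m) k = (k \in X)) -> turing_le X D.
Proof.
move=> /computable_fromE cf cP ch exP hX; apply/computable_fromE.
pose T w := 1 - P (f (nth 0 w 0)) (nth 0 w 1).
have exT v : exists m, T (m :: v) == 0.
  by have [m Pm] := exP (nth 0 v 0); exists m; rewrite /T /= Pm.
have cT : computes (oracle D) 2 T.
  apply: computes_sub (computes_const _ _ 1) _.
  apply: (computes_comp2 (h := fun e k => P e k) cP); last exact: computes_proj.
  exact: computes_comp1 cf (computes_proj _ (isT : 0 < 2)).
apply: computes_ext (computes_comp2 (h := fun e k => h e k) ch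
  (computes_comp1 cf (computes_mu exT cT))
  (computes_proj _ (isT : 0 < 1))) _.
move=> v _; case: ex_minnP => m; rewrite /T /= => Pm _; rewrite hX //.
by case: (P _ _) Pm.
Qed.

Lemma injective_unbounded (f : nat -> nat) (K : nat) :
  injective f -> exists M, forall m, M <= m -> K <= f m.
Proof.
move=> f_inj; elim: K => [|K [M leKf]]; first by exists 0.
have [[m0 fm0]|noK] := pselect (exists m, f m = K); last first.
  exists M => m /leKf; rewrite leq_eqVlt => /predU1P[fm|//].
  by case: noK; exists m.
exists (maxn M m0.+1) => m; rewrite geq_max => /andP[/leKf leK lt_m0m].
rewrite ltn_neqAle leK andbT; apply: contraTneq lt_m0m => fm.
by rewrite (f_inj m0 m) ?ltnn // fm0.
Qed.

(** * Coding initial segments by base 8 digits *)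

Section Codes.

Variable X : nat -> set nat.

(** The digit at place [j] of a code of index [i] is odd iff [j] is not in
    [X i]; it is at least 3 iff [j <= i], and then it is at least 5 iff [j] is
    in [X 0]. No such digit is 0, so 0 marks the places past the length. *)
Definition code_digit i j :=
  (j \in X i).+1 + (if j <= i then 2 * (j \in X 0).+1 else 0).

Definition segment_code i n := \sum_(j < n) code_digit i j * 8 ^ j.

(** The bound [i < n] keeps the places up to [i] inside the segment; they are exactly those with a
    digit at least 3, so the index can be read off the code. *)
Definition valid e := exists i n, i < n /\ e = segment_code i n.

Definition same_code (x y : nat) := x = y \/ ~ valid x /\ ~ valid y.

Lemma code_digit_lt8 i j : code_digit i j < 8.
Proof. by rewrite /code_digit; case: ifP; do ?case: (_ \in _). Qed.

Lemma digit_sum n (d : nat -> nat) k : (forall j, d j < 8) ->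
  digit (\sum_(j < n) d j * 8 ^ j) k = if k < n then d k else 0.
Proof.
rewrite /digit => d8; elim: n d k d8 => [|n IHn] d k d8.
  by rewrite big_ord0 div0n mod0n.
(* Splitting off the lowest digit leaves the sum for the shifted sequence of digits; hence the
   induction over all [d]. *)
have -> : \sum_(j < n.+1) d j * 8 ^ j = (\sum_(j < n) d j.+1 * 8 ^ j) * 8 + d 0.
  rewrite big_ord_recl expn0 muln1 addnC; congr (_ + _).
  by rewrite big_distrl; apply: eq_bigr => j _ /=; rewrite -mulnA -expnSr.
case: k => [|k]; first by rewrite expn0 divn1 modnMDl modn_small.
rewrite expnS divnMA divnMDl // (divn_small (d8 0)) addn0.
exact: (IHn (fun j => d j.+1)).
Qed.

Lemma digit_segment_code i n k :
  digit (segment_code i n) k = if k < n then code_digit i k else 0.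
Proof. exact: digit_sum (code_digit_lt8 i). Qed.

Lemma segment_code_lt i n : segment_code i n < 8 ^ n.
Proof.
elim: n => [|n IHn]; first by rewrite /segment_code big_ord0.
rewrite /segment_code big_ord_recr /= expnS -[8]/(1 + 7) mulnDl mul1n.
by rewrite -addSn leq_add // leq_mul2r -ltnS code_digit_lt8 orbT.
Qed.

Lemma segment_code_inj i : injective (segment_code i).
Proof.
move=> m n eq_mn; wlog lt_mn : m n eq_mn / m < n => [IH|].
  by case: (ltngtP m n) => // lt_mn; [|symmetry]; exact: IH.
(* Place [m] is past the end of the shorter code, where the digit is 0, but inside the longer one,
   where it is positive. *)
have := digit_segment_code i m m; rewrite eq_mn digit_segment_code ltnn lt_mn.
by rewrite /code_digit addSn.
Qed.

(** * Infinite sequences of pairwise inequivalent codes *)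

Lemma same_code_equivalence : Equivalence same_code.
Proof.
split=> [x|x y [->|[? ?]]|x y z [->//|[Vx Vy]] [<-|[? ?]]]; by [left|right].
Qed.

Lemma segment_code_transversal i m n :
  same_code (segment_code i (i.+1 + m)) (segment_code i (i.+1 + n)) <-> m = n.
Proof.
split=> [[/segment_code_inj/addnI//|[[]]]|->]; last by left.
by exists i, (i.+1 + m); split; rewrite ?leq_addr.
Qed.

(** Only the places up to [i] depend on [X 0]. They are stored in the constant
    [segment_code i i.+1], and each later digit takes one query to [X i]. *)
Lemma segment_code_computable i :
  computable_from (X i) (fun n => segment_code i (i.+1 + n)).
Proof.
apply/computable_fromE.
pose G w := nth 0 w 1 +
  (oracle (X i) (i.+1 + nth 0 w 0)).+1 * 8 ^ (i.+1 + nth 0 w 0).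
have co : computes (oracle (X i)) 1 (fun v => oracle (X i) (nth 0 v 0)).
  exact/computable_fromE/turing_le_refl.
have cp : computes (oracle (X i)) 3 (fun w => i.+1 + nth 0 w 0).
  by apply: computes_add; [exact: computes_const|exact: computes_proj].
apply: computes_ext (computes_rec (G := G) (computes_proj _ (isT : 0 < 1))
  (computes_const _ _ (segment_code i i.+1)) _) _.
  apply: computes_add; first exact: computes_proj.
  apply: computes_mul; last exact: computes_exp.
  by apply: computes_succ; exact: computes_comp1 co cp.
move=> v _; elim: (nth 0 v 0) => [|k IHk] /=; first by rewrite addn0.
rewrite {}IHk /G /= addnS [RHS]big_ord_recr /=; congr (_ + _ * _).
by rewrite /code_digit leqNgt leq_addr addn0.
Qed.

(** Call a place marked when its digit is at least 3, that is, when it is at most the index. The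
    cases depend on whether every place is marked in infinitely many values of [f]. *)
Lemma transversal_computes (D : set nat) f : computable_from D f ->
  (forall x y, x = y <-> same_code (f x) (f y)) -> exists i, turing_le (X i) D.
Proof.
move=> cf fS.
have f_inj : injective f by move=> x y fxy; apply/fS; left.
(* All invalid numbers are equivalent, so [f] takes at most one invalid value. *)
have [N validN] : exists N, forall m, N <= m -> valid (f m).
  have [[m0 inv0]|all_valid] := pselect (exists m, ~ valid (f m)); last first.
    by exists 0 => m _; apply: contrapT => inv; apply: all_valid; exists m.
  exists m0.+1 => m lt_m0m; apply: contrapT => inv.
  have : m0 = m by apply/fS; right.
  by move=> eq_m; rewrite eq_m ltnn in lt_m0m.
have cshift M : computable_from D (fun m => f (M + m)).
  apply/computable_fromE; apply: computes_comp1; first exact/computable_fromE.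
  by apply: computes_add; [exact: computes_const|exact: computes_proj].
have cdigit k : computes (oracle D) 2 (fun v => digit (nth 0 v 0) k).
  by apply: computes_digit; [exact: computes_proj|exact: computes_const].
have cdigit2 : computes (oracle D) 2 (fun v => digit (nth 0 v 0) (nth 0 v 1)).
  by apply: computes_digit; exact: computes_proj.
pose often k := forall M, exists2 m, M <= m & 3 <= digit (f m) k.
have [all_often|] := pselect (forall k, often k).
  (* A code marked at [k] carries membership of [k] in [X 0]: its digit there is 5 or 6 if [k] is
     in, 3 or 4 if not. *)
  exists 0; apply: (turing_le_search (f := fun m => f (N + m))
    (P := fun e k => 3 <= digit e k) (h := fun e k => 5 <= digit e k)) => //.
  - by apply: computes_leq => //; exact: computes_const.
  - by apply: computes_leq => //; exact: computes_const.
  - move=> k; have [m leNm dm] := all_often k N.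
    by exists (m - N); rewrite subnKC.
  - move=> m k; have [i [n [_ ->]]] := validN _ (leq_addr m N).
    rewrite digit_segment_code; case: ifP => // _.
    by rewrite /code_digit; case: ifP; do ?case: (_ \in _).
move=> /existsNP/(@cid _ _)[k0 rare0].
have exrare : exists k, `[< ~ often k >] by exists k0; apply/asboolP.
(* Place 0 is marked in every valid code, so the least rarely marked place is a successor [i.+1],
   and [i] is marked infinitely often. *)
case: (ex_minnP exrare) => -[|i] /asboolP rare min_rare.
  case: rare => M; exists (maxn M N); first exact: leq_maxl.
  have [i [n [lt_in ->]]] := validN _ (leq_maxr M N).
  rewrite digit_segment_code (leq_ltn_trans _ lt_in) //.
  by rewrite /code_digit /=; do ?case: (_ \in _).
have often_i : often i.
  by apply: contrapT => /asboolP/min_rare; rewrite ltnn.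
have [M rareM] : exists M, forall m, M <= m -> digit (f m) i.+1 < 3.
  apply: contrapT => noM; apply: rare => M; apply: contrapT => no_m.
  apply: noM; exists M => m leMm; rewrite ltnNge; apply/negP => dm.
  by apply: no_m; exists m.
(* A mark at [i] bounds the index below by [i]; no mark at [i.+1] bounds it above by [i]. *)
have index_i m : maxn M N <= m -> 3 <= digit (f m) i ->
    exists n, f m = segment_code i n.
  rewrite geq_max => /andP[/rareM d1 /validN[j [n [lt_jn eq_fm]]]].
  move: d1; rewrite eq_fm !digit_segment_code => d1 d0; exists n; suff -> : i = j by [].
  apply/eqP; rewrite eqn_leq; apply/andP; split.
    move: d0; case: ifP => // _; rewrite /code_digit.
    by case: (leqP i j) => // _; rewrite addn0; case: (_ \in _).
  rewrite leqNgt; apply: contraTN d1 => lt_ij.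
  rewrite (leq_ltn_trans lt_ij lt_jn) /code_digit lt_ij.
  by do ?case: (_ \in _).
(* Search for a code of index [i] whose segment contains place [k], that is, with a nonzero digit
   there; the digit is even iff [k] is in [X i]. *)
exists i; apply: (turing_le_search (f := fun m => f (maxn M N + m))
  (P := fun e k => (3 <= digit e i) && (1 <= digit e k))
  (h := fun e k => ~~ odd (digit e k))) => //.
- apply: (computes_ext (F := fun v => (3 <= digit (nth 0 v 0) i) *
    (1 <= digit (nth 0 v 0) (nth 0 v 1)))); last by move=> v _; rewrite mulnb.
  by apply: computes_mul; apply: computes_leq => //; exact: computes_const.
- apply: (computes_ext (F := fun v => odd (digit (nth 0 v 0) (nth 0 v 1)).+1)) => //.
  exact/computes_odd/computes_succ.
(* Codes of length [n] are below [8 ^ n], so a value at least [8 ^ k] has length greater than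
   [k]. *)
- move=> k; have [K leK] := injective_unbounded (8 ^ k) f_inj.
  have [m] := often_i (maxn K (maxn M N)).
  rewrite geq_max => /andP[/leK le8 leMN] dm.
  exists (m - maxn M N); rewrite subnKC // dm.
  have [n eq_fm] := index_i m leMN dm; rewrite eq_fm digit_segment_code.
  rewrite eq_fm in le8; have := leq_ltn_trans le8 (segment_code_lt i n).
  by rewrite ltn_exp2l // => ->; rewrite /code_digit addSn.
- move=> m k /andP[di dk]; have [n eq_fm] := index_i _ (leq_addr m _) di.
  move: dk; rewrite eq_fm digit_segment_code; case: ifP => // _ _.
  by rewrite /code_digit; case: ifP; do ?case: (_ \in _).
Qed.

End Codes.

(** * Infinitely many classes, and the spectrum *)

Lemma infinite_equivalence_classes (R : relation nat) (g : nat -> nat) :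
  Equivalence R -> (forall m n, R (g m) (g n) -> m = n) ->
  infinite_set (equivalence_classes R).
Proof.
move=> eqR g_inj.
have c_inj : injective (fun n => [set y | R (g n) y]).
  move=> m n eq_mn; apply: g_inj.
  have : [set y | R (g n) y] (g n) by exact: reflexivity.
  by rewrite -eq_mn.
apply: (@sub_infinite_set _ (range (fun n => [set y | R (g n) y]))).
  by move=> _ [n _ <-]; exists (g n).
rewrite (eq_finite_set (inj_card_eq (in2W c_inj))).
exact: infinite_nat.
Qed.

Theorem theorem2p4 (A : set turing_degree)
    (A_nonempty : A !=set0)
    (A_upward_closed : upward_closed A)
    (A_basis : exists2 B : set turing_degree, countable B & is_basis B A) :
  exists R S : relation nat,
    [/\ Equivalence R /\ Equivalence S,
        infinite_set (equivalence_classes R),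
        infinite_set (equivalence_classes S)
      & reducibility_spectrum R S = A].
Proof.
have [B countB [_ defA]] := A_basis.
have [b0 Bb0] : B !=set0 by case: A_nonempty => a; rewrite defA => -[b]; exists b.
(* A finite basis is enumerated with repetitions. *)
have [e eB] : exists e : nat -> turing_degree, range e = B.
  have /pfcard_geP[B0|/unsquash e] := countB; last by exists e; exact: image_eq.
  by rewrite B0 in Bb0.
(* With this choice [degree_le (e i) d] is by definition [turing_le (X i) (repr d)]. *)
pose X i := repr (e i).
have eqS := same_code_equivalence X.
exists eq, (same_code X); split.
- by split=> //; exact: eq_equivalence.
- by apply: (infinite_equivalence_classes (g := id)) => //; exact: eq_equivalence.
- by apply: infinite_equivalence_classes => // m n; exact: (segment_code_transversal X 0 m n).1.
rewrite defA -eB; apply/seteqP; split=> [d [f cf fS]|d [_ [i _ <-] le_id]].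
  by have [i le_id] := transversal_computes cf fS; exists (e i); first exists i.
exists (fun n => segment_code X i (i.+1 + n)).
  exact: computable_from_le le_id (segment_code_computable X i).
by move=> m n; split=> [->|/segment_code_transversal//]; left.
Qed.
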